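(* Let $G=(V,E)$ be a simple undirected graph with $V=\{1,\dots,n\}$, let $G_S=(V_S,E_S)$ be an induced subgraph of $G$, and let $V_I,V_O\subseteq V$. Define $W:=V_I\cap V_O$ and let $D(W)$ be the derived set of $W$ in $G$. If $V_S\subseteq D(W)$, then $(G_S;V_I;V_O)$ is identifiable.
   Context: All graphs are simple (no self-loops, at most one edge between any pair of vertices) and undirected, with vertex set $V=\{1,\dots,n\}$. A vertex $j$ is a neighbour of $i$ if $(i,j)\in E$. An induced subgraph $G_S=(V_S,E_S)$ of $G$ satisfies $V_S\subseteq V$ and, for all $i,j\in V_S$, $(i,j)\in E_S$ if and only if $(i,j)\in E$. Matrix class. $\mathcal{Q}_p(G)$ is the set of real symmetric $n\times n$ matrices $X$ such that for all $i\neq j$: $X_{ji}>0$ if $(i,j)\in E$, and $X_{ji}=0$ if $(i,j)\notin E$. The diagonal entries of $X$ are arbitrary real numbers. Input/output matrices. For $V'=\{v_1,\dots,v_r\}\subseteq V$, $P(V;V')$ is the $n\times r$ matrix with $P_{ij}=1$ if $i=v_j$ and $P_{ij}=0$ otherwise. Given input nodes $V_I\subseteq V$ and output nodes $V_O\subseteq V$, put $M=P(V;V_I)$ and $N=P(V;V_O)^\top$. Identifiability. $(G_S;V_I;V_O)$ is identifiable if for all $X,\bar X\in\mathcal{Q}_p(G)$: whenever $N(sI-X)^{-1}M=N(sI-\bar X)^{-1}M$ (as rational matrices in the complex variable $s$), then $X_S=\bar X_S$, where $X_S,\bar X_S$ are the principal submatrices of $X,\bar X$ with rows and columns indexed by $V_S$.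 Zero forcing. Vertices of $G$ are colored black or white. Color-change rule: if $u$ is a black vertex and exactly one neighbour $v$ of $u$ is white, then change the color of $v$ to black. For $Z\subseteq V$, color the vertices of $Z$ black and those of $V\setminus Z$ white; the derived set $D(Z)$ is the set of black vertices obtained by applying the color-change rule until no more changes are possible. *)

(* Defs.v *)
From HB Require Import structures.
From mathcomp Require Import all_boot all_order all_algebra.
From mathcomp Require Import reals.
From mathcomp Require Import complex.

Set Implicit Arguments.
Unset Strict Implicit.
Unset Printing Implicit Defensive.

Import Order.TTheory GRing.Theory Num.Theory.
Local Open Scope ring_scope.

(* The vertices 1, ..., n are represented by the ordinals 0, ..., n - 1. *)

Record sgraph (n : nat) := SGraph {
  edge : rel 'I_n;
  edge_sym : symmetric edge;
  edge_irr : irreflexive edge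
}.

Record induced_subgraph (n : nat) (G : sgraph n) := InducedSubgraph {
  sub_vertices : {set 'I_n};
  sub_edge : rel 'I_n;
  sub_edge_vertices : forall i j : 'I_n,
    sub_edge i j -> (i \in sub_vertices) && (j \in sub_vertices);
  sub_edgeE : forall i j : 'I_n,
    i \in sub_vertices -> j \in sub_vertices -> sub_edge i j = edge G i j
}.

Definition Qp (R : realType) (n : nat) (G : sgraph n) (X : 'M[R]_n) : Prop :=
  X^T = X /\
  forall i j : 'I_n, i != j ->
    (edge G i j -> 0 < X j i) /\ (~~ edge G i j -> X j i = 0).

(* The elements v_1, ..., v_r of V' are listed in increasing order. *)
Definition selection_mx (F : nzRingType) (n : nat) (V' : {set 'I_n}) :
    'M[F]_(n, #|V'|) :=
  \matrix_(i, j) (i == enum_val j)%:R.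

Definition principal_submx (F : Type) (n : nat) (S : {set 'I_n})
    (X : 'M[F]_n) : 'M[F]_#|S| :=
  mxsub (@enum_val _ (mem S)) (@enum_val _ (mem S)) X.

(* The field C(s) of rational functions in the complex variable s. *)
Definition ratfun (R : realType) : fieldType := {fraction {poly R[i]}}.

(* [char_poly_mx A] is 'X%:M - map_mx polyC A. *)
Definition char_ratmx (R : realType) (n : nat) (X : 'M[R]_n) :
    'M[ratfun R]_n :=
  map_mx (@tofrac {poly R[i]}) (char_poly_mx (map_mx (real_complex R) X)).

Lemma char_ratmx_unit (R : realType) (n : nat) (X : 'M[R]_n) :
  char_ratmx X \in unitmx.
Proof.
rewrite unitmxE unitfE det_map_mx tofrac_eq0.
exact/monic_neq0/char_poly_monic.
Qed.

Definition transfer_mx (R : realType) (n : nat) (VI VO : {set 'I_n})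
    (X : 'M[R]_n) : 'M[ratfun R]_(#|VO|, #|VI|) :=
  (selection_mx (ratfun R) VO)^T *m invmx (char_ratmx X)
    *m selection_mx (ratfun R) VI.

Definition identifiable (R : realType) (n : nat) (G : sgraph n)
    (GS : induced_subgraph G) (VI VO : {set 'I_n}) : Prop :=
  forall X Xbar : 'M[R]_n, Qp G X -> Qp G Xbar ->
    transfer_mx VI VO X = transfer_mx VI VO Xbar ->
    principal_submx (sub_vertices GS) X = principal_submx (sub_vertices GS) Xbar.

Section ZeroForcing.

Variables (n : nat) (G : sgraph n).

(* One application of the color-change rule; a coloring is given by its set of
   black vertices. *)
Definition color_change : rel {set 'I_n} := fun B B' =>
  [exists u in B, exists v,
     ([set w | edge G u w & w \notin B] == [set v]) && (B' == v |: B)].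

Definition color_step (B : {set 'I_n}) : {set 'I_n} :=
  if [pick B' | color_change B B'] is Some B' then B' else B.

(* Each color change adds a vertex, so n steps exhaust all changes. The result
   does not depend on the choices made by [pick]: see [derived_set_unique]. *)
Definition derived_set (Z : {set 'I_n}) : {set 'I_n} := iter n color_step Z.

Lemma color_changeP (B B' : {set 'I_n}) :
  reflect (exists u v, [/\ u \in B, [set w | edge G u w & w \notin B] = [set v]
                         & B' = v |: B])
          (color_change B B').
Proof.
apply: (iffP existsP) => [[u /andP[uB /existsP[v /andP[/eqP h1 /eqP h2]]]]|].
  by exists u, v.
case=> u [v [uB h1 h2]]; exists u; rewrite uB /=.
by apply/existsP; exists v; rewrite h1 h2 !eqxx.
Qed.

Lemma color_change_card (B B' : {set 'I_n}) :
  color_change B B' -> #|B'| = #|B|.+1.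
Proof.
case/color_changeP=> u [v [_ h ->]].
have : v \in [set w | edge G u w & w \notin B] by rewrite h set11.
by rewrite inE cardsU1 => /andP[_ ->].
Qed.

Lemma color_step_connect (B : {set 'I_n}) :
  connect color_change B (color_step B).
Proof.
by rewrite /color_step; case: pickP => [B' /connect1 //|_]; apply: connect0.
Qed.

Lemma derived_set_reached (Z : {set 'I_n}) :
  connect color_change Z (derived_set Z).
Proof.
suff reached k : connect color_change Z (iter k color_step Z) by exact: reached.
elim: k => [|k IH] /=; first exact: connect0.
exact: connect_trans IH (color_step_connect _).
Qed.

Lemma derived_set_stalled (Z B' : {set 'I_n}) :
  ~~ color_change (derived_set Z) B'.
Proof.
apply/negP => h.
have key k : (k <= #|iter k color_step Z|)%N \/
             (forall B, ~~ color_change (iter k color_step Z) B).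
  elim: k => [|k [IH|IH]] /=; first by left.
  - rewrite /color_step; case: pickP => [B /color_change_card ->|no]; first by left.
    by right=> B; rewrite no.
  - right=> B; rewrite /color_step; case: pickP => [C|_]; last exact: IH.
    by move=> hC; move: (IH C); rewrite hC.
case: (key n) => [le_n|/(_ B')]; last by rewrite -/(derived_set Z) h.
have := max_card (mem B'); rewrite card_ord (color_change_card h).
by rewrite leqNgt ltnS le_n.
Qed.

Lemma color_change_reach_sub (Z B D : {set 'I_n}) :
  connect color_change Z B -> Z \subset D ->
  (forall B', ~~ color_change D B') -> B \subset D.
Proof.
move=> /connectP[p] + -> {B}; elim: p Z => [|C p IH] Z //= /andP[hC hp] ZD stD.
apply: IH => //; case/color_changeP: hC => u [v [uZ hv ->]].
rewrite subUset sub1set ZD andbT; apply/negPn/negP => vD.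
have /negP := stD (v |: D); apply; apply/color_changeP; exists u, v.
split=> //; first exact: (subsetP ZD).
apply/eqP; rewrite eqEsubset sub1set inE vD andbT; apply/andP; split.
  rewrite -hv; apply/subsetP=> w; rewrite !inE => /andP[-> /=].
  exact/contra/subsetP.
by have: v \in [set v] by [rewrite set11]; rewrite -hv inE => /andP[].
Qed.

Lemma color_change_reach_ge (Z B : {set 'I_n}) :
  connect color_change Z B -> Z \subset B.
Proof.
move=> /connectP[p] + -> {B}; elim: p Z => [|C p IH] Z //= /andP[hC /IH].
by apply: subset_trans; case/color_changeP: hC => u [v [_ _ ->]]; apply: subsetUr.
Qed.

Lemma derived_set_unique (Z D : {set 'I_n}) :
  connect color_change Z D -> (forall B', ~~ color_change D B') ->
  D = derived_set Z.
Proof.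
move=> ZD stD; have ZD' := derived_set_reached Z.
apply/eqP; rewrite eqEsubset; apply/andP; split.
  apply: (color_change_reach_sub ZD); first exact: color_change_reach_ge.
  exact: derived_set_stalled.
by apply: (color_change_reach_sub ZD') => //; apply: color_change_reach_ge.
Qed.

End ZeroForcing.

(* Main.v *)
(* The entries of the transfer matrix determine the corresponding entries of
   all powers X^k (Markov parameters), by a degree comparison in
   adj(s - X) X^(k+1) = s adj(s - X) X^k - det(s - X) X^k.  Agreement of all
   powers of X and Xbar on B x B propagates along a forcing u -> v: since v is
   the only white neighbour of u, the entries X_vu (X^k)_iv for i in B and
   X_vu^2 (X^k)_vv are determined by the powers on B x B.  At k = 0 the latter
   gives X_vu^2, hence X_vu by positivity. *)
Require Import Defs.
From mathcomp Require Import all_boot all_order all_algebra.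
From mathcomp Require Import reals.
From mathcomp Require Import complex ring.

Set Implicit Arguments.
Unset Strict Implicit.
Unset Printing Implicit Defensive.

Import Order.TTheory GRing.Theory Num.Theory.
Local Open Scope ring_scope.

(** * Degree bounds and polynomial recurrences *)

Lemma size_det_leq (F : idomainType) (m d : nat) (A : 'M[{poly F}]_m) :
  (forall i j, size (A i j) <= d.+1)%N -> (size (\det A) <= (m * d).+1)%N.
Proof.
move=> hA; apply: (leq_trans (size_sum _ _ _)); apply/bigmax_leqP => s _.
rewrite size_Msign.
apply: (leq_trans (size_poly_prod_leq _ _)).
rewrite leq_subLR card_ord addnS ltnS.
apply: (@leq_trans (\sum_(i < m) d.+1)); first by apply: leq_sum.
by rewrite sum_nat_const card_ord mulnS.
Qed.

(** If q f_k = p g_k, the recurrences give q f_(k+1) - p g_(k+1) = (b_k - a_k) p q. The left side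
    has degree below 2n while p q is monic of degree 2n, so the scalar vanishes and the equality
    passes to k+1. *)
Lemma eq_monic_recurrence (F : idomainType) (p q : {poly F}) (n : nat)
    (f g : nat -> {poly F}) (a b : nat -> F) :
    p \is monic -> q \is monic -> size p = n.+1 -> size q = n.+1 ->
    (forall k, size (f k) <= n)%N -> (forall k, size (g k) <= n)%N ->
    (forall k, f k.+1 = 'X * f k - p * (a k)%:P) ->
    (forall k, g k.+1 = 'X * g k - q * (b k)%:P) ->
  q * f 0 = p * g 0 -> forall k, a k = b k.
Proof.
move=> p_mon q_mon sp sq sf sg fS gS h0.
have step k : q * f k = p * g k -> a k = b k /\ q * f k.+1 = p * g k.+1.
  move=> h.
  have e : q * f k.+1 - p * g k.+1 = (b k - a k) *: (p * q).
    by rewrite fS gS -mul_polyC polyCB mulrBr mulrCA h; ring.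
  have small : (size (q * f k.+1 - p * g k.+1)%R <= n + n)%N.
    have sz (r t : {poly F}) :
        size r = n.+1 -> (size t <= n)%N -> (size (r * t)%R <= n + n)%N.
      move=> hr ht; apply: (leq_trans (size_polyMleq _ _)).
      by rewrite hr addSn leq_add2l.
    by apply: (leq_trans (size_polyD _ _)); rewrite geq_max size_polyN !sz.
  have ab : a k = b k.
    apply/eqP/negPn/negP; rewrite eq_sym -subr_eq0 => nz.
    move: small; rewrite e size_scale // size_monicM ?monic_neq0 //.
    by rewrite sp sq addnS /= addSn ltnn.
  by split=> //; apply/eqP; rewrite -subr_eq0 e ab subrr scale0r.
have fg k : q * f k = p * g k by elim: k => [|k /step[]].
by move=> k; case: (step k (fg k)).
Qed.

Lemma eq_tofrac_div (D : idomainType) (a b c d : D) :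
    b != 0 -> d != 0 ->
  tofrac a / tofrac b = tofrac c / tofrac d -> d * a = b * c.
Proof.
move=> b0 d0 /eqP; rewrite eqr_div ?tofrac_eq0 // -!tofracM tofrac_eq => /eqP h.
by rewrite mulrC h mulrC.
Qed.

(** * Markov parameters from entries of the resolvent *)

Section Markov.

Variables (F : fieldType) (n : nat).
Implicit Types X Y : 'M[F]_n.

(** Up to sign the entry is a minor of order n - 1 with entries of degree at most 1; the index [i]
    forces n > 0. *)
Lemma size_adj_char_poly_mx X i j : (size ((\adj (char_poly_mx X)) i j) <= n)%N.
Proof.
rewrite mxE /cofactor size_Msign.
have n_gt0 : (0 < n)%N by case: n i {X j} => [[]|].
rewrite -[leqRHS](prednK n_gt0) -[n.-1 in leqRHS]muln1.
apply: size_det_leq => k l; rewrite !mxE.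
case: eqP => _ /=; first by rewrite mulr1n size_XsubC.
by rewrite mulr0n sub0r size_polyN (leq_trans (size_polyC_leq1 _)).
Qed.

Lemma size_adj_char_poly_mul X (Z : 'M[F]_n) i j :
  (size ((\adj (char_poly_mx X) *m map_mx polyC Z) i j) <= n)%N.
Proof.
rewrite mxE; apply: (leq_trans (size_sum _ _ _)); apply/bigmax_leqP => k _.
rewrite [map_mx _ _ _ _]mxE mulrC mul_polyC (leq_trans (size_scale_leq _ _)) //.
exact: size_adj_char_poly_mx.
Qed.

Lemma adj_char_poly_expS X k i j :
  (\adj (char_poly_mx X) *m map_mx polyC (X ^+ k.+1)) i j =
  'X * (\adj (char_poly_mx X) *m map_mx polyC (X ^+ k)) i j
  - char_poly X * ((X ^+ k) i j)%:P.
Proof.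
(* With X written as s - (s - X), the adjugate turns the factor s - X into the determinant. *)
have mapX : map_mx polyC X = 'X%:M - char_poly_mx X by rewrite opprB addrC subrK.
rewrite exprS -mulmxE map_mxM mapX mulmxA mulmxBr mul_adj_mx mulmxBl.
by rewrite mul_mx_scalar mul_scalar_mx -scalemxAl !mxE.
Qed.

Lemma eq_adj_char_poly_exp X Y i j :
    char_poly Y * (\adj (char_poly_mx X)) i j =
    char_poly X * (\adj (char_poly_mx Y)) i j ->
  forall k, (X ^+ k) i j = (Y ^+ k) i j.
Proof.
move=> h0; pose f (Z : 'M[F]_n) k : {poly F} :=
  (\adj (char_poly_mx Z) *m map_mx polyC (Z ^+ k)) i j.
have f0 Z : f Z 0 = (\adj (char_poly_mx Z)) i j.
  by rewrite /f expr0 -[1]/(1%:M) map_scalar_mx mulmx1.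
apply: (@eq_monic_recurrence _ (char_poly X) (char_poly Y) n (f X) (f Y)).
- exact: char_poly_monic.
- exact: char_poly_monic.
- exact: size_char_poly.
- exact: size_char_poly.
- by move=> k; apply: size_adj_char_poly_mul.
- by move=> k; apply: size_adj_char_poly_mul.
- by move=> k; apply: adj_char_poly_expS.
- by move=> k; apply: adj_char_poly_expS.
- by rewrite !f0.
Qed.

Lemma invmx_char_poly_mxE X i j :
  invmx (map_mx (@tofrac {poly F}) (char_poly_mx X)) i j =
  tofrac ((\adj (char_poly_mx X)) i j) / tofrac (char_poly X).
Proof.
have u : map_mx (@tofrac {poly F}) (char_poly_mx X) \in unitmx.
  rewrite unitmxE unitfE det_map_mx tofrac_eq0.
  exact/monic_neq0/char_poly_monic.
rewrite /invmx u det_map_mx -map_mx_adj.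
by rewrite [LHS]mxE [map_mx _ _ _ _]mxE mulrC.
Qed.

Lemma eq_resolvent_exp X Y i j :
    invmx (map_mx (@tofrac {poly F}) (char_poly_mx X)) i j =
    invmx (map_mx (@tofrac {poly F}) (char_poly_mx Y)) i j ->
  forall k, (X ^+ k) i j = (Y ^+ k) i j.
Proof.
move=> h; apply: eq_adj_char_poly_exp.
apply: eq_tofrac_div; try exact/monic_neq0/char_poly_monic.
(* Rewriting would unify the pattern with entries of [X ^+ k] and unfold them. *)
exact: etrans (esym (invmx_char_poly_mxE X i j))
  (etrans h (invmx_char_poly_mxE Y i j)).
Qed.

End Markov.

(** * Propagation along color changes *)

Section Forcing.

Variables (R : realType) (n : nat) (G : sgraph n).
Implicit Types (X Y : 'M[R]_n) (B : {set 'I_n}).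

(** All powers are carried along because a forcing step obtains the power k at the new vertex from
    powers up to k+2 on [B]. *)
Definition powers_agree X Y B :=
  forall i j k, i \in B -> j \in B -> (X ^+ k) i j = (Y ^+ k) i j.

(** Outside [B], column u of X vanishes except at v. The arbitrary diagonal entry X u u falls in the
    sum over [B], since u is black. *)
Lemma Qp_sum_forced X B u v (a : 'I_n -> R) :
    Qp G X -> u \in B -> [set w | edge G u w & w \notin B] = [set v] ->
  \sum_w a w * X w u = \sum_(w in B) a w * X w u + a v * X v u.
Proof.
move=> [_ hX] uB hv; rewrite (bigID (mem B)) /=; congr (_ + _).
have : v \in [set w | edge G u w & w \notin B] by rewrite hv set11.
rewrite inE => /andP[_ vB].
rewrite (bigD1 v) //= big1 ?addr0 // => w /andP[wB wv].
have uw : u != w by apply: contraNneq wB => <-.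
have [_ ->] := hX u w uw; first by rewrite mulr0.
have := in_set1 w v; rewrite -hv inE wB andbT (negbTE wv) => ->; exact: isT.
Qed.

Lemma powers_agree_color_change X Y B B' :
    Qp G X -> Qp G Y -> color_change G B B' ->
  powers_agree X Y B -> powers_agree X Y B'.
Proof.
move=> qX qY /color_changeP[u [v [uB hv ->]]] XY.
have : v \in [set w | edge G u w & w \notin B] by rewrite hv set11.
rewrite inE => /andP[uv vB].
have u_neq_v : u != v by apply: contraNneq vB => <-.
have sym (Z : 'M[R]_n) : Qp G Z -> forall k i j, (Z ^+ k) i j = (Z ^+ k) j i.
  move=> [tZ _] k i j; rewrite -[in RHS]tZ.
  suff -> : Z^T ^+ k = (Z ^+ k)^T by rewrite mxE.
  elim: k => [|k IH]; first by rewrite !expr0 trmx1.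
  by rewrite exprS exprSr IH -mulmxE trmx_mul.
have XY1 i j : i \in B -> j \in B -> X i j = Y i j.
  by move=> iB jB; have := XY i j 1%N iB jB; rewrite !expr1.
(* Expand the (i,u) entry of X^(k+1) = X^k X along column u: the terms over [B] agree and cancel,
   leaving the term at v. *)
have hi k i : i \in B -> (X ^+ k) i v * X v u = (Y ^+ k) i v * Y v u.
  move=> iB; have := XY i u k.+1 iB uB.
  rewrite !exprSr -!mulmxE ![(_ *m _) _ _]mxE.
  rewrite (Qp_sum_forced _ qX uB hv) (Qp_sum_forced _ qY uB hv).
  rewrite (eq_bigr (fun w => (Y ^+ k) i w * Y w u)); first exact: addrI.
  by move=> w wB; rewrite XY // XY1.
(* [hi] at i = u and k+1 compares (X^(k+1)) u v X v u. By symmetry the power's entry expands along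
   column u; [hi] matches the terms over [B], leaving the one at v. *)
have hvv k : (X ^+ k) v v * X v u ^+ 2 = (Y ^+ k) v v * Y v u ^+ 2.
  have expand (Z : 'M[R]_n) : Qp G Z -> (Z ^+ k.+1) u v * Z v u =
      \sum_(w in B) (Z ^+ k) w v * Z v u * Z w u + (Z ^+ k) v v * Z v u ^+ 2.
    move=> qZ; rewrite sym // exprSr -mulmxE mxE (Qp_sum_forced _ qZ uB hv).
    rewrite mulrDl mulr_suml -mulrA -expr2; congr (_ + _).
    by apply: eq_bigr => w _; rewrite sym // mulrAC.
  have := hi k.+1 u uB; rewrite !expand //.
  rewrite (eq_bigr (fun w => (Y ^+ k) w v * Y v u * Y w u)); first exact: addrI.
  by move=> w wB; rewrite hi // XY1.
have pos (Z : 'M[R]_n) : Qp G Z -> 0 < Z v u by case=> _ /(_ u v u_neq_v)[/(_ uv)].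
have XYvu : X v u = Y v u.
  have := hvv 0%N; rewrite !expr0 !mxE eqxx !mul1r => /eqP.
  by rewrite eqrXn2 ?ltW ?pos // => /eqP.
have nz : Y v u != 0 by rewrite gt_eqF ?pos.
have hiv k i : i \in B -> (X ^+ k) i v = (Y ^+ k) i v.
  by move=> iB; apply: (mulIf nz); rewrite -hi // XYvu.
move=> i j k; rewrite !in_setU1 => /predU1P[->|iB] /predU1P[->|jB].
- by apply: (mulIf (expf_neq0 2 nz)); rewrite -hvv XYvu.
- by rewrite sym // hiv // sym.
- exact: hiv.
- exact: XY.
Qed.

Lemma powers_agree_derived_set X Y B :
  Qp G X -> Qp G Y -> powers_agree X Y B -> powers_agree X Y (derived_set G B).
Proof.
move=> qX qY; have /connectP[p + ->] := derived_set_reached G B.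
elim: p B => [|C p IH] B //= /andP[hC hp] XY.
exact/(IH _ hp)/(powers_agree_color_change qX qY hC).
Qed.

End Forcing.

Lemma transfer_mxE (R : realType) (n : nat) (VI VO : {set 'I_n}) (X : 'M[R]_n) i j :
  transfer_mx VI VO X i j = invmx (char_ratmx X) (enum_val i) (enum_val j).
Proof.
rewrite /transfer_mx !mxE (bigD1 (enum_val j)) //= !mxE eqxx mulr1.
rewrite [X in _ + X]big1 => [|k /negbTE hk]; last by rewrite [in X in _ * X]mxE hk mulr0.
rewrite addr0 (bigD1 (enum_val i)) //= !mxE eqxx mul1r.
by rewrite big1 ?addr0 // => k /negbTE hk; rewrite !mxE hk mul0r.
Qed.

(** Rows are read through [VO] and columns through [VI], so a vertex in both can serve as either
    index, as forcing requires. *)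
Lemma eq_transfer_mx_powers_agree (R : realType) (n : nat) (VI VO : {set 'I_n})
    (X Y : 'M[R]_n) :
  transfer_mx VI VO X = transfer_mx VI VO Y -> powers_agree X Y (VI :&: VO).
Proof.
move=> h i j k; rewrite !inE => /andP[_ iO] /andP[jI _].
have hE (Z : 'M[R]_n) :
    transfer_mx VI VO Z (enum_rank_in iO i) (enum_rank_in jI j) =
    invmx (char_ratmx Z) i j.
  apply: etrans (transfer_mxE _ _ _) _.
  by rewrite (enum_rankK_in iO iO) (enum_rankK_in jI jI).
have hij : invmx (char_ratmx X) i j = invmx (char_ratmx Y) i j.
  by apply: etrans (esym (hE X)) (etrans _ (hE Y)); rewrite h.
(* Powers are compared over [R[i]]; the embedding of R commutes with powers and is injective, so
   equality descends. *)
have mapX (Z : 'M[R]_n) :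
    map_mx (real_complex R) Z ^+ k = map_mx (real_complex R) (Z ^+ k).
  elim: k => [|k IH]; first by rewrite !expr0 -[1 in LHS]/(1%:M) map_mx1.
  by rewrite !exprS IH -!mulmxE map_mxM.
have := eq_resolvent_exp hij k.
by rewrite !mapX ![map_mx _ _ _ _]mxE => /complexI.
Qed.

Theorem theorem2 (R : realType) (n : nat) (G : sgraph n)
    (GS : induced_subgraph G) (VI VO : {set 'I_n})
    (hS : sub_vertices GS \subset derived_set G (VI :&: VO)) :
  identifiable R GS VI VO.
Proof.
move=> X Y qX qY /eq_transfer_mx_powers_agree.
move=> /(powers_agree_derived_set qX qY) XY.
apply/matrixP => i j; rewrite !mxE.
by have := XY _ _ 1%N (subsetP hS _ (enum_valP i)) (subsetP hS _ (enum_valP j));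
  rewrite !expr1.
Qed.
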